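(* Let $(A,\mathfrak{g})$ be a Lie Rinehart pair with exterior algebra $\bigwedge\mathfrak{g}_A$. The Schouten-Nijenhuis bracket $[\cdot,\cdot]$ on $\bigwedge\mathfrak{g}_A$ is an $\mathbb{R}$-bilinear, graded antisymmetric operator, homogeneous of degree zero with respect to the antisymmetric grading $\deg$, and in particular the equations $$[x,y]=-(-1)^{\deg(x)\deg(y)}[y,x],\qquad [x,y\wedge z]=[x,y]\wedge z+(-1)^{\deg(x)(\deg(y)-1)}y\wedge[x,z],$$ as well as the graded Jacobi equation in its antisymmetric form $$(-1)^{\deg(x)\deg(z)}[x,[y,z]]+(-1)^{\deg(x)\deg(y)}[y,[z,x]]+(-1)^{\deg(y)\deg(z)}[z,[x,y]]=0,$$ are satisfied for any homogeneous tensors $x,y,z\in\bigwedge\mathfrak{g}_A$.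
   Context: A Lie Rinehart pair $(A,\mathfrak{g})$ consists of a real associative commutative algebra $A$ with unit, a real Lie algebra $\mathfrak{g}$, an $A$-module structure $(a,x)\mapsto a\cdot x$ on the vector space $\mathfrak{g}$, and a Lie algebra morphism $D:\mathfrak{g}\to \mathrm{Der}(A)$, $x\mapsto D_x$, into the Lie algebra of ($\mathbb{R}$-linear) derivations of $A$ (with commutator bracket), such that the Leibniz rule $[x,a\cdot y]=D_x(a)\cdot y+a\cdot[x,y]$ holds for all $x,y\in\mathfrak{g}$, $a\in A$. $\bigwedge\mathfrak{g}_A=\bigoplus_{n\ge0}\bigwedge^n_A\mathfrak{g}$ is the exterior algebra of the $A$-module $\mathfrak{g}$, with $\bigwedge^0_A\mathfrak{g}=A$, $\bigwedge^1_A\mathfrak{g}=\mathfrak{g}$. For $x\in\bigwedge^n_A\mathfrak{g}$ the tensor degree is $|x|=n$ and the antisymmetric degree is $\deg(x)=n-1$. The (antisymmetric) Schouten-Nijenhuis bracket is the map $[\cdot,\cdot]:\bigwedge\mathfrak{g}_A\times\bigwedge\mathfrak{g}_A\to\bigwedge\mathfrak{g}_A$ defined by $[a,b]=0$ and $[x,a]=-[a,x]=D_x(a)$ for scalars $a,b\in A$ and vectors $x\in\mathfrak{g}$, by $$[x_1\wedge\cdots\wedge x_n,y_1\wedge\cdots\wedge y_m]=\sum_{i,j}(-1)^{i+j}[x_i,y_j]\wedge x_1\wedge\cdots\wedge\widehat{x_i}\wedge\cdots\wedge x_n\wedge y_1\wedge\cdots\wedge\widehat{y_j}\wedge\cdots\wedge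 y_m$$ on simple tensors ($x_i,y_j\in\mathfrak{g}$, $n,m\ge1$, hats denote omission), and extended to all of $\bigwedge\mathfrak{g}_A$ by additivity. Between a scalar $a\in A$ and a simple tensor with $n\ge 1$ factors it reads $$[x_1\wedge\cdots\wedge x_n,a]=\sum_i(-1)^{n-i}D_{x_i}(a)\cdot x_1\wedge\cdots\wedge\widehat{x_i}\wedge\cdots\wedge x_n,\qquad [a,x_1\wedge\cdots\wedge x_n]=\sum_i(-1)^{i}D_{x_i}(a)\cdot x_1\wedge\cdots\wedge\widehat{x_i}\wedge\cdots\wedge x_n.$$
   Formalization: The formal theorem also assumes that D is A-linear, D_{a·x}(b) = a D_x(b); without this the stated Leibniz rule fails (A = R[t], g = Rx, t acting by 0, zero bracket, D_x = t d/dt), and the Leibniz rule for two scalars and a vector forces it. *)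

(* Defs.v *)
From HB Require Import structures.
From mathcomp Require Import all_boot all_order all_algebra.
From mathcomp Require Import boolp reals.

Set Implicit Arguments.
Unset Strict Implicit.
Unset Printing Implicit Defensive.

Import GRing.Theory.
Local Open Scope ring_scope.
Local Open Scope quotient_scope.

(* A commutative real algebra, given by its structure morphism: the action of
   r : R on a : A is [struct_morph A r * a]. [comAlgType R] is not used because
   it excludes the zero algebra. *)
Record comRealAlg (R : realType) := ComRealAlg {
  comRealAlg_ring :> comPzRingType;
  struct_morph : {rmorphism R -> comRealAlg_ring}
}.

(* The exterior algebra of the A-module g is the unital associative A-algebra
   generated by symbols [TVec x], for x in g, subject to the A-linearity of
   [TVec] and to [TVec x * TVec x = 0]: it is the quotient of the terms over
   A and g by the least congruence [ext_eq] containing the algebra axioms and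
   these relations. Its universal property is [exterior_universal]. *)
Section ExteriorAlgebra.
Variables (A : comPzRingType) (g : lmodType A).

Inductive ext_term : Type :=
| TScal of A
| TVec of g
| TAdd of ext_term & ext_term
| TMul of ext_term & ext_term.

Inductive ext_eq : ext_term -> ext_term -> Prop :=
| ext_refl t : ext_eq t t
| ext_sym s t : ext_eq s t -> ext_eq t s
| ext_trans s t u : ext_eq s t -> ext_eq t u -> ext_eq s u
| ext_congD s s' t t' :
    ext_eq s s' -> ext_eq t t' -> ext_eq (TAdd s t) (TAdd s' t')
| ext_congM s s' t t' :
    ext_eq s s' -> ext_eq t t' -> ext_eq (TMul s t) (TMul s' t')
| ext_addA s t u : ext_eq (TAdd s (TAdd t u)) (TAdd (TAdd s t) u)
| ext_addC s t : ext_eq (TAdd s t) (TAdd t s)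
| ext_add0 t : ext_eq (TAdd (TScal 0) t) t
| ext_addN t : ext_eq (TAdd (TMul (TScal (- 1)) t) t) (TScal 0)
| ext_mulA s t u : ext_eq (TMul s (TMul t u)) (TMul (TMul s t) u)
| ext_mul1 t : ext_eq (TMul (TScal 1) t) t
| ext_mulDl s t u :
    ext_eq (TMul (TAdd s t) u) (TAdd (TMul s u) (TMul t u))
| ext_mulDr s t u :
    ext_eq (TMul s (TAdd t u)) (TAdd (TMul s t) (TMul s u))
| ext_scalD a b : ext_eq (TScal (a + b)) (TAdd (TScal a) (TScal b))
| ext_scalM a b : ext_eq (TScal (a * b)) (TMul (TScal a) (TScal b))
| ext_scalC a t : ext_eq (TMul (TScal a) t) (TMul t (TScal a))
| ext_vecD x y : ext_eq (TVec (x + y)) (TAdd (TVec x) (TVec y))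
| ext_vecZ a x : ext_eq (TVec (a *: x)) (TMul (TScal a) (TVec x))
| ext_vec2 x : ext_eq (TMul (TVec x) (TVec x)) (TScal 0).

HB.instance Definition _ := gen_eqMixin ext_term.
HB.instance Definition _ := gen_choiceMixin ext_term.

Definition ext_rel : rel ext_term := fun s t => `[< ext_eq s t >].

Lemma ext_rel_equiv : equiv_class_of ext_rel.
Proof.
split.
- by move=> t; apply/asboolP; exact: ext_refl.
- by move=> s t; apply/asboolP/asboolP => /ext_sym.
- move=> t s u /asboolP st /asboolP tu; apply/asboolP.
  exact: ext_trans st tu.
Qed.

Canonical ext_equiv := EquivRelPack ext_rel_equiv.

Definition exterior := {eq_quot ext_rel}.

HB.instance Definition _ := Choice.on exterior.
HB.instance Definition _ := EqQuotient.on exterior.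

Definition ext_class (t : ext_term) : exterior := \pi_exterior t.

Lemma ext_classP s t : ext_class s = ext_class t <-> ext_eq s t.
Proof.
split; first by move/eqP; rewrite /ext_class eqmodE /= => /asboolP.
by move=> st; apply/eqP; rewrite /ext_class eqmodE /=; apply/asboolP.
Qed.

Lemma ext_classW (P : exterior -> Prop) :
  (forall t, P (ext_class t)) -> forall u, P u.
Proof. by move=> PP u; rewrite -[u]reprK; apply: PP. Qed.

Definition exterior_zero : exterior := ext_class (TScal 0).
Definition exterior_one : exterior := ext_class (TScal 1).
Definition exterior_add (u v : exterior) : exterior :=
  ext_class (TAdd (repr u) (repr v)).
Definition exterior_mul (u v : exterior) : exterior :=
  ext_class (TMul (repr u) (repr v)).
Definition exterior_opp (u : exterior) : exterior :=
  exterior_mul (ext_class (TScal (- 1))) u.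
Definition exterior_scale (a : A) (u : exterior) : exterior :=
  exterior_mul (ext_class (TScal a)) u.

Lemma repr_class t : ext_eq (repr (ext_class t)) t.
Proof. by apply/ext_classP; rewrite /ext_class reprK. Qed.

Lemma exterior_addE s t :
  exterior_add (ext_class s) (ext_class t) = ext_class (TAdd s t).
Proof. by apply/ext_classP/ext_congD; apply: repr_class. Qed.

Lemma exterior_mulE s t :
  exterior_mul (ext_class s) (ext_class t) = ext_class (TMul s t).
Proof. by apply/ext_classP/ext_congM; apply: repr_class. Qed.

Lemma exterior_addA : associative exterior_add.
Proof.
elim/ext_classW=> s; elim/ext_classW=> t; elim/ext_classW=> u.
rewrite !exterior_addE; apply/ext_classP; exact: ext_addA.
Qed.

Lemma exterior_addC : commutative exterior_add.
Proof.
elim/ext_classW=> s; elim/ext_classW=> t.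
rewrite !exterior_addE; apply/ext_classP; exact: ext_addC.
Qed.

Lemma exterior_add0 : left_id exterior_zero exterior_add.
Proof.
elim/ext_classW=> t; rewrite exterior_addE; apply/ext_classP; exact: ext_add0.
Qed.

Lemma exterior_addN : left_inverse exterior_zero exterior_opp exterior_add.
Proof.
elim/ext_classW=> t; rewrite /exterior_opp exterior_mulE exterior_addE.
apply/ext_classP; exact: ext_addN.
Qed.

HB.instance Definition _ := GRing.isZmodule.Build exterior
  exterior_addA exterior_addC exterior_add0 exterior_addN.

Lemma exterior_mulA : associative exterior_mul.
Proof.
elim/ext_classW=> s; elim/ext_classW=> t; elim/ext_classW=> u.
rewrite !exterior_mulE; apply/ext_classP; exact: ext_mulA.
Qed.

Lemma exterior_mul1l : left_id exterior_one exterior_mul.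
Proof.
elim/ext_classW=> t; rewrite exterior_mulE; apply/ext_classP; exact: ext_mul1.
Qed.

Lemma exterior_mul1r : right_id exterior_one exterior_mul.
Proof.
elim/ext_classW=> t; rewrite exterior_mulE; apply/ext_classP.
apply: ext_trans (ext_mul1 t); exact/ext_sym/ext_scalC.
Qed.

Lemma exterior_mulDl : left_distributive exterior_mul exterior_add.
Proof.
elim/ext_classW=> s; elim/ext_classW=> t; elim/ext_classW=> u.
rewrite !(exterior_mulE, exterior_addE); apply/ext_classP; exact: ext_mulDl.
Qed.

Lemma exterior_mulDr : right_distributive exterior_mul exterior_add.
Proof.
elim/ext_classW=> s; elim/ext_classW=> t; elim/ext_classW=> u.
rewrite !(exterior_mulE, exterior_addE); apply/ext_classP; exact: ext_mulDr.
Qed.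

HB.instance Definition _ := GRing.Zmodule_isPzRing.Build exterior
  exterior_mulA exterior_mul1l exterior_mul1r exterior_mulDl exterior_mulDr.

Lemma exterior_scaleA a b u :
  exterior_scale a (exterior_scale b u) = exterior_scale (a * b) u.
Proof.
rewrite /exterior_scale exterior_mulA exterior_mulE; congr exterior_mul.
by apply/ext_classP/ext_sym/ext_scalM.
Qed.

Lemma exterior_scaleDl u :
  {morph exterior_scale^~ u : a b / a + b >-> a + b}.
Proof.
move=> a b; rewrite /exterior_scale -[RHS]exterior_mulDl exterior_addE.
by congr exterior_mul; apply/ext_classP/ext_scalD.
Qed.

HB.instance Definition _ := GRing.Zmodule_isLmodule.Build A exterior
  exterior_scaleA exterior_mul1l
  (fun a => exterior_mulDr (ext_class (TScal a))) exterior_scaleDl.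

Lemma exterior_scaleAl (a : A) (u v : exterior) : a *: (u * v) = (a *: u) * v.
Proof. exact: exterior_mulA. Qed.

Lemma exterior_scaleAr (a : A) (u v : exterior) : a *: (u * v) = u * (a *: v).
Proof.
rewrite exterior_scaleAl [RHS]exterior_mulA; congr exterior_mul.
elim/ext_classW: u => t; rewrite /GRing.scale /= /exterior_scale !exterior_mulE.
by apply/ext_classP/ext_scalC.
Qed.

Definition extv (x : g) : exterior := ext_class (TVec x).

Lemma extv_is_linear : linear extv.
Proof.
move=> a x y; rewrite /extv [LHS](_ : _ = ext_class (TAdd (TVec (a *: x)) (TVec y))).
  rewrite -exterior_addE; congr exterior_add.
  by rewrite /GRing.scale /= /exterior_scale exterior_mulE; apply/ext_classP/ext_vecZ.
by apply/ext_classP/ext_vecD.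
Qed.

HB.instance Definition _ :=
  GRing.isLinear.Build A g exterior *:%R extv extv_is_linear.

Lemma extv_sqr x : extv x * extv x = 0.
Proof. by rewrite [LHS]exterior_mulE; apply/ext_classP/ext_vec2. Qed.

(* The inclusion of A as the 0-th exterior power. *)
Definition exts (a : A) : exterior := a *: (1 : exterior).

Definition wedge (n : nat) (x : 'I_n -> g) : exterior :=
  \prod_(i < n) extv (x i).

(* u belongs to the n-th exterior power; for n = 0 the tensor [wedge (x k)] is
   the empty product 1, hence the 0-th power is A *: 1. *)
Definition ext_pow (n : nat) (u : exterior) : Prop :=
  exists (l : nat) (a : 'I_l -> A) (x : 'I_l -> 'I_n -> g),
    u = \sum_(k < l) a k *: wedge (x k).

(* u is homogeneous of antisymmetric degree d, i.e. of tensor degree d + 1;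
   there is no nonzero tensor of negative tensor degree. *)
Definition has_deg (d : int) (u : exterior) : Prop :=
  match (d + 1)%R with
  | Posz n => ext_pow n u
  | Negz _ => u = 0
  end.

End ExteriorAlgebra.

(* B is an A-algebra through phi. *)
Section Universal.
Variables (A : comPzRingType) (g : lmodType A) (B : pzRingType).
Variables (phi : {rmorphism A -> B}).
Variables (phiC : forall a v, phi a * v = v * phi a).
Variables (f : {additive g -> B}).
Variables (fZ : forall a x, f (a *: x) = phi a * f x).
Variables (f_sqr : forall x, f x * f x = 0).

Fixpoint ext_eval (t : ext_term g) : B :=
  match t with
  | TScal a => phi a
  | TVec x => f x
  | TAdd s t => ext_eval s + ext_eval t
  | TMul s t => ext_eval s * ext_eval t
  end.

Lemma ext_eval_eq s t : ext_eq s t -> ext_eval s = ext_eval t.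
Proof.
elim=> //=.
- by move=> ? ? ? _ -> _ ->.
- by move=> ? ? ? ? _ -> _ ->.
- by move=> ? ? ? ? _ -> _ ->.
- by move=> *; rewrite addrA.
- by move=> *; rewrite addrC.
- by move=> ?; rewrite rmorph0 add0r.
- by move=> ?; rewrite rmorphN1 mulN1r addNr rmorph0.
- by move=> *; rewrite mulrA.
- by move=> ?; rewrite rmorph1 mul1r.
- by move=> *; rewrite mulrDl.
- by move=> *; rewrite mulrDr.
- by move=> *; rewrite rmorphD.
- by move=> *; rewrite rmorphM.
- by move=> *; rewrite raddfD.
- by move=> *; rewrite f_sqr rmorph0.
Qed.

Definition exterior_lift (u : exterior g) : B := ext_eval (repr u).

Lemma exterior_liftE t : exterior_lift (ext_class t) = ext_eval t.
Proof. exact/ext_eval_eq/repr_class. Qed.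

Lemma exterior_universal :
  exists! h : exterior g -> B,
    [/\ forall a u v, h (a *: u + v) = phi a * h u + h v,
        monoid_morphism h & forall x, h (extv x) = f x].
Proof.
exists exterior_lift; split.
  have hD : {morph exterior_lift : u v / u + v}.
    elim/ext_classW=> s; elim/ext_classW=> t.
    by rewrite [_ + _]exterior_addE !exterior_liftE.
  have hM : {morph exterior_lift : u v / u * v}.
    elim/ext_classW=> s; elim/ext_classW=> t.
    by rewrite [_ * _]exterior_mulE !exterior_liftE.
  split=> [a u v||x]; last by rewrite exterior_liftE.
    by rewrite hD [a *: u](_ : _ = ext_class (TScal g a) * u) //
               hM exterior_liftE.
  by split=> //; rewrite [LHS]exterior_liftE /= rmorph1.
move=> h [hL [h1 hM] hv]; apply/funext; elim/ext_classW=> t.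
have hD u v : h (u + v) = h u + h v.
  by have := hL 1 u v; rewrite scale1r rmorph1 mul1r.
have h0 : h 0 = 0 by apply: (addrI (h 0)); rewrite -hD !addr0.
rewrite exterior_liftE; elim: t => [a|x|s IHs t IHt|s IHs t IHt] /=.
- have -> : ext_class (TScal g a) = a *: (1 : exterior g) + 0.
    by rewrite addr0; exact/esym/exterior_mul1r.
  by rewrite hL h1 h0 addr0 mulr1.
- by rewrite -hv.
- by rewrite IHs IHt -hD; congr h; exact/exterior_addE.
- by rewrite IHs IHt -hM; congr h; exact/exterior_mulE.
Qed.

End Universal.

(* The real vector space underlying an A-module V, for a real algebra A. *)
Definition rscale (R : realType) (A : comRealAlg R) (V : lmodType A)
  (r : R) (v : V) : V := struct_morph A r *: v.

Notation "r *r: v" := (rscale r v) (at level 40).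

Section LieRinehart.
Variables (R : realType) (A : comRealAlg R) (g : lmodType A).

Record lieRinehart := LieRinehart {
  lie : g -> g -> g;
  anchor : g -> A -> A;
  lie_linearl : forall (r : R) (x y z : g),
    lie (r *r: x + y) z = r *r: lie x z + lie y z;
  lie_linearr : forall (r : R) (x y z : g),
    lie z (r *r: x + y) = r *r: lie z x + lie z y;
  lie_alt : forall x, lie x x = 0;
  lie_jacobi : forall x y z,
    lie x (lie y z) + lie y (lie z x) + lie z (lie x y) = 0;
  anchor_der_linear : forall (x : g) (r : R) (a b : A),
    anchor x (struct_morph A r * a + b) = struct_morph A r * anchor x a + anchor x b;
  anchor_derM : forall (x : g) (a b : A),
    anchor x (a * b) = anchor x a * b + a * anchor x b;
  anchor_linear : forall (r : R) (x y : g) (a : A),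
    anchor (r *r: x + y) a = struct_morph A r * anchor x a + anchor y a;
  anchor_lie : forall (x y : g) (a : A),
    anchor (lie x y) a = anchor x (anchor y a) - anchor y (anchor x a);
  lie_leibniz : forall (x y : g) (a : A),
    lie x (a *: y) = anchor x a *: y + a *: lie x y
}.

(* A-linearity of the anchor is part of the usual notion of a Lie-Rinehart
   pair but does not follow from [lieRinehart]: take A = R[t], g = R with t
   acting by 0, the zero bracket and D_x = x t d/dt. It is necessary for the
   Leibniz rule of the Schouten-Nijenhuis bracket, which for scalars a, b and
   a vector x gives - D_(a x) b = [b, a /\ x] = a /\ [b, x] = - a D_x b. *)
Definition anchor_Alinear (L : lieRinehart) : Prop :=
  forall (a : A) (x : g) (b : A), anchor L (a *: x) b = a * anchor L x b.

Local Notation E := (exterior g).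

(* The indices i < n.+1 start at 0, which shifts the exponents: (i + 1) + (j + 1)
   has the parity of i + j, and (n + 1) - (i + 1) = n - i. The family
   [x \o lift i] is x with its i-th term omitted. *)
Record is_schouten (L : lieRinehart) (br : E -> E -> E) : Prop := IsSchouten {
  schouten_addl : forall u v w, br (u + v) w = br u w + br v w;
  schouten_addr : forall u v w, br w (u + v) = br w u + br w v;
  schouten_scal : forall a b : A, br (exts g a) (exts g b) = 0;
  schouten_tensor_scal : forall (n : nat) (x : 'I_n.+1 -> g) (a : A),
    br (wedge x) (exts g a) =
      \sum_(i < n.+1) (-1) ^+ (n - i) * (anchor L (x i) a *: wedge (x \o lift i));
  schouten_scal_tensor : forall (n : nat) (x : 'I_n.+1 -> g) (a : A),
    br (exts g a) (wedge x) =
      \sum_(i < n.+1) (-1) ^+ i.+1 * (anchor L (x i) a *: wedge (x \o lift i));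
  schouten_tensor : forall (n m : nat) (x : 'I_n.+1 -> g) (y : 'I_m.+1 -> g),
    br (wedge x) (wedge y) =
      \sum_(i < n.+1) \sum_(j < m.+1)
        (-1) ^+ (i + j) *
        (extv (lie L (x i) (y j)) * wedge (x \o lift i) * wedge (y \o lift j))
}.

End LieRinehart.

(* Main.v *)
Require Import Defs.
From HB Require Import structures.
From mathcomp Require Import all_boot all_order all_algebra.
From mathcomp Require Import boolp reals.

(** The bracket of a tensor [w] is a graded derivation of the exterior algebra,
and a graded derivation is the same thing as its values on the scalars and on
the vectors, provided these values respect the relations between generators
([extend_derP], [gder_eq]). Everything follows from this principle.

Construction. A vector [x] acts by the derivation [lie_der x] that extends the
anchor and the Lie bracket, and a scalar [a] by the odd derivation
[contraction a], which kills scalars and sends [x] to [- D_x a]. Antisymmetry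
then forces the bracket of a tensor [w] of given parity with the generators:
[w, a] is [contraction a w] up to sign and [w, x] is [- lie_der x w]. These
values do extend to a derivation, called [ad]; the point is that [lie_der] is
not A-linear in [x], but its failure to be so, [lie_derZl], is exactly the
Leibniz rule required of the extension. Evaluating derivations on
x_1 /\ ... /\ x_n ([gder_wedge]) gives the explicit formulas that define the
Schouten-Nijenhuis bracket ([bracket_is_schouten]), and these determine a
biadditive map because scalars and decomposable tensors span.

Identities. The Leibniz rule holds by construction. Antisymmetry ([bracketC])
is proved by induction on the number of factors of the first argument, once
the bracket is known to be a derivation of that argument too
([bracket_mul_extvl]); this last identity compares two derivations of the second
argument. The defect of the Jacobi identity is a derivation of its third
argument, and rotating its arguments changes it only by a sign
([jacobiator_rot]). It therefore vanishes as soon as it vanishes on generators,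
where it amounts to the Jacobi identity of the Lie algebra, to the anchor being
a morphism of Lie algebras, or to 0 = 0.

All the signs depend on degrees modulo 2 only, so degrees are replaced by
booleans. *)

Set Implicit Arguments.
Unset Strict Implicit.
Unset Printing Implicit Defensive.

Import GRing.Theory.
Local Open Scope ring_scope.

Lemma addr_cross (V : zmodType) (a b c d a' d' : V) :
  a + b + (c + d) - (a' + c + (b + d')) = (a - a') + (d - d').
Proof.
have -> : a + b + (c + d) = (a + d) + (b + c).
  by rewrite (AC (2*2) ((1*4)*(2*3))).
have -> : a' + c + (b + d') = (a' + d') + (b + c).
  by rewrite (AC (2*2) ((1*4)*(3*2))).
by rewrite opprD addrACA subrr addr0 opprD addrACA.
Qed.

(** * The exterior algebra and its grading involution *)

Section ExteriorTheory.
Variables (A : comPzRingType) (g : lmodType A).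
Local Notation E := (exterior g).
Implicit Types (u v w : E) (x y : g) (a b : A) (p q : bool) (m n : nat).

Lemma exts_class a : ext_class (TScal g a) = exts g a.
Proof. exact/esym/exterior_mul1r. Qed.

Lemma exterior_ind (P : E -> Prop) :
    (forall a, P (exts g a)) -> (forall x, P (extv x)) ->
    (forall u v, P u -> P v -> P (u + v)) ->
    (forall u v, P u -> P v -> P (u * v)) ->
  forall u, P u.
Proof.
move=> Ps Pv PD PM; elim/ext_classW; elim=> [a|x|s IHs t IHt|s IHs t IHt].
- by rewrite exts_class.
- exact: Pv.
- by rewrite -exterior_addE; apply: PD.
- by rewrite -exterior_mulE; apply: PM.
Qed.

Lemma scale_exts a u : a *: u = exts g a * u.
Proof. by rewrite -exts_class. Qed.

Lemma exts_comm a u : exts g a * u = u * exts g a.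
Proof. by rewrite -scale_exts /exts -exterior_scaleAr mulr1. Qed.

Lemma exts_is_zmod : zmod_morphism (exts g).
Proof. by move=> a b; rewrite /exts scalerBl. Qed.

Lemma exts_is_monoid : monoid_morphism (exts g).
Proof.
by split=> [|a b]; rewrite /exts ?scale1r // -exterior_scaleAl mul1r scalerA.
Qed.

HB.instance Definition _ :=
  GRing.isZmodMorphism.Build A E (exts g) exts_is_zmod.
HB.instance Definition _ :=
  GRing.isMonoidMorphism.Build A E (exts g) exts_is_monoid.

Lemma extsD a b : exts g (a + b) = exts g a + exts g b.
Proof. exact: rmorphD. Qed.

Lemma extsM a b : exts g (a * b) = exts g a * exts g b.
Proof. exact: rmorphM. Qed.

Lemma extsN a : exts g (- a) = - exts g a.
Proof. exact: rmorphN. Qed.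

Lemma exts0 : exts g 0 = 0.
Proof. exact: rmorph0. Qed.

Lemma exts1 : exts g 1 = 1.
Proof. exact: rmorph1. Qed.

Lemma extvD x y : extv (x + y) = extv x + extv y.
Proof. exact: linearD. Qed.

Lemma extvN x : extv (- x) = - extv x.
Proof. exact: linearN. Qed.

Lemma extvZ a x : extv (a *: x) = a *: extv x.
Proof. exact: linearZ. Qed.

Lemma extvC x y : extv x * extv y = - (extv y * extv x).
Proof.
apply/eqP; rewrite -addr_eq0; apply/eqP.
have := extv_sqr (x + y).
by rewrite linearD mulrDl !mulrDr !extv_sqr add0r addr0.
Qed.

(** The automorphism acting on the n-th exterior power by (-1)^n. *)
Definition grade_inv : E -> E := exterior_lift (exts g) (\- @extv A g).

Lemma grade_inv_class t :
  grade_inv (ext_class t) = ext_eval (exts g) (\- @extv A g) t.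
Proof.
apply: exterior_liftE; first exact: exts_comm.
- by move=> a x; rewrite /= linearZ /= scale_exts mulrN.
- by move=> x; rewrite /= mulrNN extv_sqr.
Qed.

Lemma grade_inv_exts a : grade_inv (exts g a) = exts g a.
Proof. by rewrite -exts_class grade_inv_class /= exts_class. Qed.

Lemma grade_inv_extv x : grade_inv (extv x) = - extv x.
Proof. exact: grade_inv_class. Qed.

Lemma grade_invD : {morph grade_inv : u v / u + v}.
Proof.
elim/ext_classW=> s; elim/ext_classW=> t.
by rewrite [_ + _]exterior_addE !grade_inv_class.
Qed.

Lemma grade_invM : {morph grade_inv : u v / u * v}.
Proof.
elim/ext_classW=> s; elim/ext_classW=> t.
by rewrite [_ * _]exterior_mulE !grade_inv_class.
Qed.

Lemma grade_inv0 : grade_inv 0 = 0.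
Proof. by apply: (addrI (grade_inv 0)); rewrite -grade_invD !addr0. Qed.

Lemma grade_invN u : grade_inv (- u) = - grade_inv u.
Proof. by apply/eqP; rewrite -addr_eq0 -grade_invD addNr grade_inv0. Qed.

Lemma grade_invK : involutive grade_inv.
Proof.
elim/exterior_ind => [a|x|u v Hu Hv|u v Hu Hv].
- by rewrite !grade_inv_exts.
- by rewrite grade_inv_extv grade_invN grade_inv_extv opprK.
- by rewrite !grade_invD Hu Hv.
- by rewrite !grade_invM Hu Hv.
Qed.

Lemma grade_invZ a u : grade_inv (a *: u) = a *: grade_inv u.
Proof. by rewrite !scale_exts grade_invM grade_inv_exts. Qed.

(** Parity of the tensor degree. As an eigenvalue condition it is inherited by
images of graded maps without decomposing the tensor into simple ones. *)
Definition parity q u := grade_inv u = (-1) ^+ q * u.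
(** The Koszul sign of moving a symbol of degree [p] across [u], for [u] not
necessarily homogeneous. *)
Definition twist p u := if p then grade_inv u else u.

Lemma parity0 q : parity q 0.
Proof. by rewrite /parity mulr0 grade_inv0. Qed.

Lemma parityD q u v : parity q u -> parity q v -> parity q (u + v).
Proof. by rewrite /parity grade_invD mulrDr => -> ->. Qed.

Lemma parityN q u : parity q u -> parity q (- u).
Proof. by rewrite /parity grade_invN mulrN => ->. Qed.

Lemma parity_sign q (b : bool) u : parity q u -> parity q ((-1) ^+ b * u).
Proof. by rewrite mulr_sign; case: b => // /parityN. Qed.

Lemma parityZ q a u : parity q u -> parity q (a *: u).
Proof. by rewrite /parity grade_invZ -exterior_scaleAr => ->. Qed.

Lemma parity_exts a : parity false (exts g a).
Proof. by rewrite /parity grade_inv_exts mul1r. Qed.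

Lemma parity_extv x : parity true (extv x).
Proof. by rewrite /parity grade_inv_extv mulN1r. Qed.

Lemma parityM p q u v : parity p u -> parity q v -> parity (p (+) q) (u * v).
Proof.
rewrite /parity grade_invM !mulr_sign => -> ->.
by case: p q => [] [] /=; rewrite ?mulrNN ?mulNr ?mulrN.
Qed.

Lemma twistM p u v : twist p (u * v) = twist p u * twist p v.
Proof. by case: p; rewrite //= grade_invM. Qed.

Lemma twist_twist p q u : twist p (twist q u) = twist (p (+) q) u.
Proof. by rewrite /twist; case: p q => [] []; rewrite //= grade_invK. Qed.

Lemma grade_inv_sign (b : bool) u :
  grade_inv ((-1) ^+ b * u) = (-1) ^+ b * grade_inv u.
Proof. by rewrite !mulr_sign; case: b; rewrite ?grade_invN. Qed.

Lemma parity_twist p q u : parity q u -> twist p u = (-1) ^+ (p && q) * u.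
Proof. by case: p => //= _; rewrite mul1r. Qed.

(** Each vector factor of [u] anticommutes with [x], and [grade_inv] counts
these factors. *)
Lemma mul_extv u x : u * extv x = extv x * grade_inv u.
Proof.
elim/exterior_ind: u => [a|y|u v Hu Hv|u v Hu Hv].
- by rewrite grade_inv_exts exts_comm.
- by rewrite grade_inv_extv mulrN extvC.
- by rewrite grade_invD mulrDl mulrDr Hu Hv.
- by rewrite grade_invM -mulrA Hv !mulrA Hu.
Qed.

(** Graded commutativity, with only one factor homogeneous. *)
Lemma parity_comm p c u : parity p c -> c * u = twist p u * c.
Proof.
move=> pc; elim/exterior_ind: u => [a|x|u v Hu Hv|u v Hu Hv].
- by rewrite (parity_twist _ (parity_exts a)) andbF mul1r exts_comm.
- rewrite (parity_twist _ (parity_extv x)) andbT mul_extv pc -mulrA !mulr_sign.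
  by case: p {pc}; rewrite ?mulrN.
- by rewrite mulrDr Hu Hv -mulrDl; case: p {pc Hu Hv}; rewrite //= grade_invD.
- by rewrite mulrA Hu twistM -mulrA Hv mulrA.
Qed.

(** * Graded derivations *)

(** That [D] be homogeneous, as its last field says, does not follow from the
twisted Leibniz rule, and graded commutators need it. *)
Record graded_der p (D : E -> E) : Prop := GDer {
  gderD : {morph D : u v / u + v};
  gderM : forall u v, D (u * v) = D u * v + twist p u * D v;
  gder_grade_inv : forall u, grade_inv (D u) = (-1) ^+ p * D (grade_inv u)
}.

(** Defined on terms for arbitrary data on the generators: the data become an
actual derivation of the quotient in [extend_derP]. *)
Fixpoint extend_der_term p (d0 : A -> E) (d1 : g -> E) (t : ext_term g) : E :=
  match t with
  | TScal a => d0 a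
  | TVec x => d1 x
  | TAdd s t => extend_der_term p d0 d1 s + extend_der_term p d0 d1 t
  | TMul s t => extend_der_term p d0 d1 s * ext_class t +
                twist p (ext_class s) * extend_der_term p d0 d1 t
  end.

Definition extend_der p d0 d1 u := extend_der_term p d0 d1 (repr u).

Section Construct.
Variables (p : bool) (d0 : A -> E) (d1 : g -> E).
Hypothesis d0D : {morph d0 : a b / a + b}.
Hypothesis d0M : forall a b, d0 (a * b) = b *: d0 a + a *: d0 b.
Hypothesis d0p : forall a, parity p (d0 a).
Hypothesis d1D : {morph d1 : x y / x + y}.
Hypothesis d1Z : forall a x, d1 (a *: x) = d0 a * extv x + a *: d1 x.
Hypothesis d1p : forall x, parity (~~ p) (d1 x).

Let twist_exts a : twist p (exts g a) = exts g a.
Proof. by rewrite (parity_twist _ (parity_exts a)) andbF mul1r. Qed.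

Let twistD u v : twist p (u + v) = twist p u + twist p v.
Proof. by rewrite /twist; case: p; rewrite ?grade_invD. Qed.

(** Among the defining relations, two are not formal. That scalars are central is
preserved because [d0 a] has the parity of the derivation and so commutes with
everything up to [twist p]; that [x] squares to zero is preserved because
[d1 x] has the opposite parity, so that the two terms of the Leibniz rule
cancel. *)
Lemma extend_der_term_eq s t :
  ext_eq s t -> extend_der_term p d0 d1 s = extend_der_term p d0 d1 t.
Proof.
have d00 : d0 0 = 0 by apply: (addrI (d0 0)); rewrite -d0D !addr0.
have d01 : d0 1 = 0.
  by apply: (addrI (d0 1)); rewrite addr0 -[in RHS](mulr1 1) d0M !scale1r.
have d0N1 : d0 (- 1) = 0.
  by apply: (addrI (d0 1)); rewrite -d0D subrr d00 d01 addr0.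
elim=> //= {s t}.
- by move=> s t u _ -> _ ->.
- by move=> s s' t t' _ -> _ ->.
- by move=> s s' t t' /ext_classP -> -> /ext_classP -> ->.
- by move=> s t u; rewrite addrA.
- by move=> s t; rewrite addrC.
- by move=> t; rewrite d00 add0r.
- move=> t; rewrite d0N1 mul0r add0r exts_class twist_exts rmorphN1 mulN1r.
  by rewrite addNr d00.
- move=> s t u; rewrite -!exterior_mulE.
  by rewrite !mulrDl mulrDr !mulrA addrA twistM.
- by move=> t; rewrite d01 mul0r add0r exts_class twist_exts rmorph1 mul1r.
- move=> s t u; rewrite -!exterior_addE twistD !mulrDl !addrA.
  by rewrite (addrAC (extend_der_term _ _ _ s * _)).
- move=> s t u; rewrite -!exterior_addE !mulrDr !addrA.
  by rewrite (addrAC (extend_der_term _ _ _ s * _)).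
- move=> a b; rewrite !exts_class twist_exts d0M -!scale_exts.
  by rewrite -exts_comm -scale_exts.
  (* scalars are central *)
- move=> a t; rewrite !exts_class twist_exts (parity_comm _ (d0p a)) addrC.
  by rewrite exts_comm.
- by move=> a x; rewrite d1Z exts_class twist_exts scale_exts.
  (* squares of vectors vanish *)
- move=> x; rewrite d00 mul_extv d1p (parity_twist _ (parity_extv x)) andbT.
  by case: (p); rewrite /= ?mul1r ?mulN1r ?mulNr ?mulrN ?subrr ?addNr.
Qed.

Lemma extend_der_class t :
  extend_der p d0 d1 (ext_class t) = extend_der_term p d0 d1 t.
Proof. exact/extend_der_term_eq/repr_class. Qed.

Lemma extend_der_exts a : extend_der p d0 d1 (exts g a) = d0 a.
Proof. by rewrite -exts_class extend_der_class. Qed.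

Lemma extend_der_extv x : extend_der p d0 d1 (extv x) = d1 x.
Proof. exact: extend_der_class. Qed.

Lemma extend_derP : graded_der p (extend_der p d0 d1).
Proof.
have DD : {morph extend_der p d0 d1 : u v / u + v}.
  elim/ext_classW=> s; elim/ext_classW=> t.
  by rewrite [_ + _]exterior_addE !extend_der_class.
have DM u v : extend_der p d0 d1 (u * v) =
    extend_der p d0 d1 u * v + twist p u * extend_der p d0 d1 v.
  elim/ext_classW: u=> s; elim/ext_classW: v=> t.
  by rewrite [ext_class s * ext_class t]exterior_mulE !extend_der_class.
split=> //; elim/exterior_ind => [a|x|u v Hu Hv|u v Hu Hv].
- by rewrite grade_inv_exts extend_der_exts d0p.
- rewrite grade_inv_extv extend_der_extv d1p.
  have -> : extend_der p d0 d1 (- extv x) = - d1 x.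
    rewrite -extend_der_extv; apply/eqP; rewrite -addr_eq0 -DD addNr.
    by apply/eqP/(addrI (extend_der p d0 d1 0)); rewrite -DD !addr0.
  by rewrite !mulr_sign; case: p => //=; rewrite opprK.
- by rewrite !(grade_invD, DD) Hu Hv mulrDr.
- rewrite !(grade_invM, grade_invD, DM) Hu Hv !mulr_sign /twist.
  by case: (p); rewrite /= ?mulNr ?mulrN ?opprD.
Qed.
End Construct.

Section GDerTheory.
Variables (p : bool) (D : E -> E).
Hypothesis gD : graded_der p D.

Lemma gder0 : D 0 = 0.
Proof. by apply: (addrI (D 0)); rewrite -(gderD gD) !addr0. Qed.

Lemma gderN u : D (- u) = - D u.
Proof. by apply/eqP; rewrite -addr_eq0 -(gderD gD) addNr gder0. Qed.

Lemma gder_sign (b : bool) u : D ((-1) ^+ b * u) = (-1) ^+ b * D u.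
Proof. by rewrite !mulr_sign; case: b; rewrite ?gderN. Qed.

Lemma parity_gder q u : parity q u -> parity (p (+) q) (D u).
Proof.
move=> pu; rewrite /parity (gder_grade_inv gD) pu gder_sign mulrA.
by rewrite -signr_addb.
Qed.

Lemma gderZ a u : D (a *: u) = D (exts g a) * u + a *: D u.
Proof.
rewrite scale_exts (gderM gD) (parity_twist _ (parity_exts a)) andbF mul1r.
by rewrite -scale_exts.
Qed.
End GDerTheory.

Lemma gder_eq p D D' : graded_der p D -> graded_der p D' ->
  (forall a, D (exts g a) = D' (exts g a)) ->
  (forall x, D (extv x) = D' (extv x)) -> D =1 D'.
Proof.
move=> gD gD' HS HV; elim/exterior_ind => // [u v Hu Hv|u v Hu Hv].
- by rewrite (gderD gD) (gderD gD') Hu Hv.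
- by rewrite (gderM gD) (gderM gD') Hu Hv.
Qed.

Lemma gder_zero p : graded_der p (fun=> 0).
Proof.
split=> [u v|u v|u]; first by rewrite addr0.
- by rewrite mul0r mulr0 addr0.
- by rewrite (parity0 false) !mulr0.
Qed.

Lemma gder_add p D D' : graded_der p D -> graded_der p D' ->
  graded_der p (fun u => D u + D' u).
Proof.
move=> gD gD'; split=> [u v|u v|u].
- by rewrite (gderD gD) (gderD gD') addrACA.
- by rewrite (gderM gD) (gderM gD') mulrDr mulrDl addrACA.
- by rewrite grade_invD (gder_grade_inv gD) (gder_grade_inv gD') mulrDr.
Qed.

Lemma gder_opp p D : graded_der p D -> graded_der p (fun u => - D u).
Proof.
move=> gD; split=> [u v|u v|u].
- by rewrite (gderD gD) opprD.
- by rewrite (gderM gD) opprD mulNr mulrN.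
- by rewrite grade_invN (gder_grade_inv gD) mulrN.
Qed.

Lemma gder_scale p a D : graded_der p D -> graded_der p (fun u => a *: D u).
Proof.
move=> gD; split=> [u v|u v|u].
- by rewrite (gderD gD) scalerDr.
- by rewrite (gderM gD) scalerDr exterior_scaleAl exterior_scaleAr.
- by rewrite grade_invZ (gder_grade_inv gD) exterior_scaleAr.
Qed.

Lemma gder_mull p q c D : graded_der p D -> parity q c ->
  graded_der (q (+) p) (fun u => c * D u).
Proof.
move=> gD pc; split=> [u v|u v|u].
- by rewrite (gderD gD) mulrDr.
- by rewrite (gderM gD) mulrDr !mulrA (parity_comm (twist p u) pc) twist_twist.
- rewrite grade_invM (gder_grade_inv gD) pc signr_addb -!mulrA.
  by rewrite !mulr_sign; case: (p) (q) => [] []; rewrite /= ?mulrN.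
Qed.

(** In the expansion of the commutator on a product, the mixed terms
[D u * D' v] and [D' u * D v] occur, up to twists, twice with opposite signs. *)
Lemma gder_comm p q D D' : graded_der p D -> graded_der q D' ->
  graded_der (p (+) q) (fun u => D (D' u) - (-1) ^+ (p && q) * D' (D u)).
Proof.
move=> gD gD'; split=> [u v|u v|u].
- by rewrite (gderD gD') !(gderD gD) (gderD gD') mulrDr opprD addrACA.
- have h1 : twist p (D' u) = (-1) ^+ (p && q) * D' (twist p u).
    by case: (p); rewrite ?mul1r //= (gder_grade_inv gD').
  have h2 : D (twist q u) = (-1) ^+ (p && q) * twist q (D u).
    case: (q); rewrite ?andbF ?mul1r //= andbT (gder_grade_inv gD) mulrA.
    by rewrite -expr2 sqrr_sign mul1r.
  rewrite (gderM gD') (gderD gD) !(gderM gD) (gderD gD') !(gderM gD').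
  rewrite h1 h2 !twist_twist (addbC q) !mulrDr -!mulrA addr_cross mulrBl mulrA.
  by rewrite mulrN !mulr_sign; case: ifP; rewrite ?mulrN.
- rewrite grade_invD grade_invN grade_inv_sign !(gder_grade_inv gD).
  rewrite !(gder_grade_inv gD') (gder_sign gD) !(gder_grade_inv gD).
  rewrite (gder_sign gD').
  by rewrite !mulr_sign; case: (p) (q) => [] []; rewrite /= ?opprD ?opprK.
Qed.

(** * Decomposable tensors and exterior powers *)

Lemma wedge0 (x : 'I_0 -> g) : wedge x = 1.
Proof. by rewrite /wedge big_ord0. Qed.

Lemma wedge_recl n (x : 'I_n.+1 -> g) :
  wedge x = extv (x ord0) * wedge (x \o lift ord0).
Proof. by rewrite /wedge big_ord_recl. Qed.

Lemma wedge_recr n (x : 'I_n.+1 -> g) :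
  wedge x = wedge (fun i => x (widen_ord (leqnSn n) i)) * extv (x ord_max).
Proof. exact: big_ord_recr. Qed.

Lemma wedge1 (x : 'I_1 -> g) : wedge x = extv (x ord0).
Proof. by rewrite wedge_recl wedge0 mulr1. Qed.

Lemma wedge_lift n (x : 'I_n.+2 -> g) (i : 'I_n.+1) :
  wedge (x \o lift (lift ord0 i)) =
    extv (x ord0) * wedge ((x \o lift ord0) \o lift i).
Proof.
rewrite wedge_recl; congr (extv (x _) * _); first exact/val_inj.
apply: eq_bigr => j _ /=; congr (extv (x _)).
by apply/val_inj; rewrite /= /bump /= !add1n ltnS addnS.
Qed.

Lemma parity_wedge n (x : 'I_n -> g) : parity (odd n) (wedge x).
Proof.
elim: n x => [|n IHn] x; first by rewrite wedge0 -exts1; apply: parity_exts.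
rewrite wedge_recl oddS -addTb.
by apply: parityM; [apply: parity_extv | apply: IHn].
Qed.

(** The signs do not depend on the parity of [D]: moving [D x_i] to the front
across [i] vectors contributes [(-1) ^ (i (p + 1))], and the Leibniz rule
[(-1) ^ (i p)]. *)
Lemma gder_wedge p (D : E -> E) n (x : 'I_n.+1 -> g) : graded_der p D ->
  D (wedge x) =
    \sum_(i < n.+1) (-1) ^+ i * (D (extv (x i)) * wedge (x \o lift i)).
Proof.
move=> gD; elim: n x => [|n IHn] x.
  by rewrite big_ord1 wedge1 wedge0 mul1r mulr1.
rewrite wedge_recl (gderM gD) IHn [RHS]big_ord_recl expr0 mul1r; congr (_ + _).
rewrite mulr_sumr; apply: eq_bigr => i _; rewrite wedge_lift.
have pD := parity_gder gD (parity_extv (x (lift ord0 i))).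
rewrite [in RHS]mulrA mul_extv pD (parity_twist _ (parity_extv _)) andbT.
rewrite lift0 -(signr_odd _ i) -(signr_odd _ i.+1) oddS addbT !mulr_sign.
by case: (p) (odd i) => [] []; rewrite /= ?(mulrN, mulNr) ?opprK mulrA.
Qed.

Lemma ext_pow_wedge n (x : 'I_n -> g) : ext_pow n (wedge x).
Proof.
by exists 1, (fun=> 1), (fun=> x); rewrite big_ord1 scale1r.
Qed.

Lemma ext_pow0 n : ext_pow n (0 : E).
Proof. by exists 0, (fun=> 0), (fun _ _ => 0); rewrite big_ord0. Qed.

Lemma ext_powZ n a u : ext_pow n u -> ext_pow n (a *: u).
Proof.
case=> l [c [x ->]]; exists l, (fun k => a * c k), x.
by rewrite scaler_sumr; apply: eq_bigr => k _; rewrite scalerA.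
Qed.

Lemma ext_powD n u v : ext_pow n u -> ext_pow n v -> ext_pow n (u + v).
Proof.
case=> l [c [x ->]] [l' [c' [x' ->]]].
exists (l + l')%N, (fun k => match split k with inl i => c i | inr i => c' i end),
  (fun k => match split k with inl i => x i | inr i => x' i end).
rewrite big_split_ord /=; congr (_ + _); apply: eq_bigr => i _.
  by rewrite (unsplitK (inl i)).
by rewrite (unsplitK (inr i)).
Qed.

Lemma ext_pow_sum n I r (P : pred I) (F : I -> E) :
  (forall i, P i -> ext_pow n (F i)) -> ext_pow n (\sum_(i <- r | P i) F i).
Proof.
by move=> H; elim/big_ind: _ => //; [apply: ext_pow0 | apply: ext_powD].
Qed.

Lemma ext_powN n u : ext_pow n u -> ext_pow n (- u).
Proof. by rewrite -scaleN1r; apply: ext_powZ. Qed.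

Lemma ext_pow_sign n (k : nat) u : ext_pow n u -> ext_pow n ((-1) ^+ k * u).
Proof. by rewrite -signr_odd mulr_sign; case: odd => // /ext_powN. Qed.

Lemma ext_pow_ind n (P : E -> Prop) :
    P 0 -> (forall u v, P u -> P v -> P (u + v)) ->
    (forall a (x : 'I_n -> g), P (a *: wedge x)) ->
  forall u, ext_pow n u -> P u.
Proof.
by move=> P0 PD Pw u [l [c [x ->]]]; elim/big_ind: _ => // i _; apply: Pw.
Qed.

Lemma ext_powM m n u v :
  ext_pow m u -> ext_pow n v -> ext_pow (m + n) (u * v).
Proof.
move=> pu pv; elim/ext_pow_ind: u / pu => [|u u' Hu Hu'|a x].
- by rewrite mul0r; apply: ext_pow0.
- by rewrite mulrDl; apply: ext_powD.
elim/ext_pow_ind: v / pv => [|v v' Hv Hv'|b y].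
- by rewrite mulr0; apply: ext_pow0.
- by rewrite mulrDr; apply: ext_powD.
rewrite -exterior_scaleAl -exterior_scaleAr; do 2!apply: ext_powZ.
pose z k := match split k with inl i => x i | inr i => y i end.
suff -> : wedge x * wedge y = wedge z by apply: ext_pow_wedge.
rewrite /wedge big_split_ord /=; congr (_ * _); apply: eq_bigr => i _.
  by rewrite /z (unsplitK (inl i)).
by rewrite /z (unsplitK (inr i)).
Qed.

Lemma ext_pow_extv (x : g) : ext_pow 1 (extv x).
Proof.
rewrite -[x]/((fun _ : 'I_1 => x) ord0) -wedge1; exact: ext_pow_wedge.
Qed.

Lemma ext_pow_exts a : ext_pow 0 (exts g a).
Proof.
rewrite /exts -(wedge0 (fun=> 0)); apply/ext_powZ/ext_pow_wedge.
Qed.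

Lemma parity_ext_pow n u : ext_pow n u -> parity (odd n) u.
Proof.
elim/ext_pow_ind; [exact: parity0|exact: parityD|move=> a x].
exact/parityZ/parity_wedge.
Qed.

(** A scalar coefficient can be absorbed into the first vector. *)
Lemma scale_wedge n a (x : 'I_n.+1 -> g) :
  exists y : 'I_n.+1 -> g, a *: wedge x = wedge y.
Proof.
exists (fun i => if i == ord0 then a *: x i else x i).
rewrite wedge_recl [RHS]wedge_recl /= exterior_scaleAl; congr (_ * _).
exact/esym/linearZ.
Qed.

(** The span of the exterior powers. It is a subring containing all the
generators, hence everything. *)
Inductive hom_span : E -> Prop :=
| hom_span_pow n u of ext_pow n u : hom_span u
| hom_spanD u v of hom_span u & hom_span v : hom_span (u + v).

(** Induction over the tensors on which the Schouten-Nijenhuis bracket is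
prescribed. *)
Lemma exterior_wedge_ind (P : E -> Prop) :
    (forall u v, P u -> P v -> P (u + v)) ->
    (forall a, P (exts g a)) ->
    (forall n (x : 'I_n.+1 -> g), P (wedge x)) ->
  forall u, P u.
Proof.
move=> PD Ps Pw.
have PE n v : ext_pow n v -> P v.
  elim/ext_pow_ind => // [|a x]; first by rewrite -exts0; apply: Ps.
  case: n x => [|n] x; last by case: (scale_wedge a x) => y ->.
  by rewrite wedge0; apply: Ps.
suff SM u v : hom_span v -> hom_span (v * u).
  have PS v : hom_span v -> P v.
    by elim=> [n w|w w' _ Hw _]; [apply: PE|apply: PD].
  move=> u; rewrite -[u]mul1r -exts1.
  exact/PS/SM/hom_span_pow/ext_pow_exts.
elim/exterior_ind: u v => [a|x|u w Hu Hw|u w Hu Hw] v Sv.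
- elim: Sv => [n {}v pv|{}v w _ Hv _ Hw]; last by rewrite mulrDl; apply: hom_spanD.
  exact/hom_span_pow/(ext_powM pv)/ext_pow_exts.
- elim: Sv => [n {}v pv|{}v w _ Hv _ Hw]; last by rewrite mulrDl; apply: hom_spanD.
  exact/hom_span_pow/(ext_powM pv)/ext_pow_extv.
- by rewrite mulrDr; apply: hom_spanD; [apply: Hu | apply: Hw].
- by rewrite mulrA; apply/Hw/Hu.
Qed.

End ExteriorTheory.

(** * Consequences of the Lie-Rinehart axioms *)

Section Bracket.
Variables (R : realType) (A : comRealAlg R) (g : lmodType A).
Variables (L : lieRinehart g) (anchorA : anchor_Alinear L).
Local Notation E := (exterior g).
Local Notation lie := (lie L).
Local Notation anchor := (anchor L).
Implicit Types (u v w : E) (x y z : g) (a b : A) (p q r : bool).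

Lemma rscale1 (V : lmodType A) (v : V) : 1 *r: v = v.
Proof. by rewrite /rscale rmorph1 scale1r. Qed.

Lemma lieDl x y z : lie (x + y) z = lie x z + lie y z.
Proof. by have := lie_linearl L 1 x y z; rewrite !rscale1. Qed.

Lemma lieDr z x y : lie z (x + y) = lie z x + lie z y.
Proof. by have := lie_linearr L 1 x y z; rewrite !rscale1. Qed.

Lemma lieC x y : lie x y = - lie y x.
Proof.
apply/eqP; rewrite -addr_eq0; apply/eqP.
by have := lie_alt L (x + y); rewrite lieDl !lieDr !lie_alt add0r addr0.
Qed.

Lemma lie0r x : lie x 0 = 0.
Proof. by apply: (addrI (lie x 0)); rewrite -lieDr !addr0. Qed.

Lemma lieNr x y : lie x (- y) = - lie x y.
Proof. by apply/eqP; rewrite -addr_eq0 -lieDr addNr lie0r. Qed.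

Lemma anchorDr x a b : anchor x (a + b) = anchor x a + anchor x b.
Proof. by have := anchor_der_linear L x 1 a b; rewrite rmorph1 !mul1r. Qed.

Lemma anchorDl x y a : anchor (x + y) a = anchor x a + anchor y a.
Proof. by have := anchor_linear L 1 x y a; rewrite rmorph1 mul1r rscale1. Qed.

Lemma anchor0r x : anchor x 0 = 0.
Proof. by apply: (addrI (anchor x 0)); rewrite -anchorDr !addr0. Qed.

Lemma anchor_struct x (c : R) : anchor x (struct_morph A c) = 0.
Proof.
have a1 : anchor x 1 = 0.
  apply: (addrI (anchor x 1)).
  by rewrite addr0 -[in RHS](mulr1 1) anchor_derM mulr1 mul1r.
have := anchor_der_linear L x c 1 0.
by rewrite mulr1 addr0 a1 mulr0 anchor0r addr0.
Qed.

(** * Construction of the bracket *)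

(** The Lie derivative along [x], which is to be [x, -]. *)
Definition lie_der x : E -> E :=
  extend_der false (fun a => exts g (anchor x a)) (fun y => extv (lie x y)).

Lemma lie_der_spec x :
  [/\ graded_der false (lie_der x),
      forall a, lie_der x (exts g a) = exts g (anchor x a) &
      forall y, lie_der x (extv y) = extv (lie x y)].
Proof.
have h1 : {morph (fun a => exts g (anchor x a)) : a b / a + b}.
  by move=> a b; rewrite anchorDr extsD.
have h2 a b : exts g (anchor x (a * b)) =
    b *: exts g (anchor x a) + a *: exts g (anchor x b).
  by rewrite anchor_derM (mulrC _ b) extsD !extsM !scale_exts.
have h4 : {morph (fun y => extv (lie x y)) : y z / y + z}.
  by move=> y z; rewrite lieDr extvD.
have h5 a y : extv (lie x (a *: y)) =
    exts g (anchor x a) * extv y + a *: extv (lie x y).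
  by rewrite lie_leibniz extvD !extvZ -scale_exts.
split; [apply: extend_derP | apply: extend_der_exts | apply: extend_der_extv] => // *;
  by [apply: parity_exts | apply: parity_extv].
Qed.

(** The contraction with [- D a], seen as a linear form on vectors; it is to be
[a, -]. That it is well defined is the A-linearity of the anchor. *)
Definition contraction a : E -> E :=
  extend_der true (fun=> 0) (fun x => - exts g (anchor x a)).

Lemma contraction_spec a :
  [/\ graded_der true (contraction a),
      forall b, contraction a (exts g b) = 0 &
      forall x, contraction a (extv x) = - exts g (anchor x a)].
Proof.
have h1 : {morph (fun _ : A => 0 : E) : a b / a + b} by move=> *; rewrite addr0.
have h2 (b c : A) : 0 = c *: 0 + b *: 0 :> E by rewrite !scaler0 addr0.
have h4 : {morph (fun x => - exts g (anchor x a)) : y z / y + z}.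
  by move=> y z; rewrite anchorDl extsD opprD.
have h5 b y : - exts g (anchor (b *: y) a) =
    0 * extv y + b *: (- exts g (anchor y a)).
  by rewrite mul0r add0r anchorA extsM scale_exts mulrN.
split; [apply: extend_derP | apply: extend_der_exts | apply: extend_der_extv] => // *;
  by [apply: parity0 | apply/parityN/parity_exts].
Qed.

Lemma lie_der_graded x : graded_der false (lie_der x).
Proof. by case: (lie_der_spec x). Qed.
Lemma lie_der_exts x a : lie_der x (exts g a) = exts g (anchor x a).
Proof. by case: (lie_der_spec x). Qed.
Lemma lie_der_extv x y : lie_der x (extv y) = extv (lie x y).
Proof. by case: (lie_der_spec x). Qed.
Lemma contraction_graded a : graded_der true (contraction a).
Proof. by case: (contraction_spec a). Qed.
Lemma contraction_exts a b : contraction a (exts g b) = 0.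
Proof. by case: (contraction_spec a). Qed.
Lemma contraction_extv a x : contraction a (extv x) = - exts g (anchor x a).
Proof. by case: (contraction_spec a). Qed.

Lemma contractionD a b u :
  contraction (a + b) u = contraction a u + contraction b u.
Proof.
apply: (gder_eq (contraction_graded _)
                (gder_add (contraction_graded a) (contraction_graded b))).
  by move=> c; rewrite !contraction_exts addr0.
by move=> x; rewrite !contraction_extv anchorDr extsD opprD.
Qed.

Lemma contractionM a b u :
  contraction (a * b) u = b *: contraction a u + a *: contraction b u.
Proof.
have G c d := gder_scale c (contraction_graded d).
apply: (gder_eq (contraction_graded _) (gder_add (G _ _) (G _ _))).
  by move=> c; rewrite !contraction_exts !scaler0 addr0.
move=> x; rewrite !contraction_extv anchor_derM !scalerN -opprD (mulrC _ b).
by rewrite !scale_exts extsD !extsM.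
Qed.

Lemma contraction_struct (c : R) u : contraction (struct_morph A c) u = 0.
Proof.
apply: (gder_eq (contraction_graded _) (gder_zero g true)) => [b|x].
  exact: contraction_exts.
by rewrite contraction_extv anchor_struct exts0 oppr0.
Qed.

Lemma lie_derDl x y u : lie_der (x + y) u = lie_der x u + lie_der y u.
Proof.
apply: (gder_eq (lie_der_graded _)
                (gder_add (lie_der_graded x) (lie_der_graded y))).
  by move=> c; rewrite !lie_der_exts anchorDl extsD.
by move=> z; rewrite !lie_der_extv lieDl extvD.
Qed.

(** The Lie derivative is A-linear in [x] only up to the term that the Leibniz
rule for [- , u] predicts. *)
Lemma lie_derZl a x u :
  lie_der (a *: x) u = a *: lie_der x u + extv x * contraction a u.
Proof.
have G := gder_scale a (lie_der_graded x).
have G' : graded_der false (fun u => extv x * contraction a u).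
  exact: (gder_mull (contraction_graded a) (parity_extv x)).
apply: (gder_eq (lie_der_graded _) (gder_add G G')).
  move=> c; rewrite !lie_der_exts contraction_exts anchorA mulr0 addr0 extsM.
  by rewrite scale_exts.
move=> y; rewrite !lie_der_extv contraction_extv mulrN -exts_comm -scale_exts.
rewrite lieC lie_leibniz extvN extvD !extvZ opprD addrC.
by rewrite lieC extvN scalerN opprK.
Qed.

(** The operation [w, -] for [w] of tensor parity [q]; the values on generators
are those that antisymmetry forces. *)
Definition ad q w : E -> E :=
  extend_der (~~ q) (fun a => (-1) ^+ q * contraction a w) (fun x => - lie_der x w).

Lemma ad_spec q w : parity q w ->
  [/\ graded_der (~~ q) (ad q w),
      forall a, ad q w (exts g a) = (-1) ^+ q * contraction a w &
      forall x, ad q w (extv x) = - lie_der x w].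
Proof.
move=> pw.
have h1 : {morph (fun a => (-1) ^+ q * contraction a w) : a b / a + b}.
  by move=> a b; rewrite contractionD mulrDr.
have h2 a b : (-1) ^+ q * contraction (a * b) w =
    b *: ((-1) ^+ q * contraction a w) + a *: ((-1) ^+ q * contraction b w).
  by rewrite contractionM mulrDr !exterior_scaleAr.
have h3 a : parity (~~ q) ((-1) ^+ q * contraction a w).
  exact/parity_sign/(parity_gder (contraction_graded a) pw).
have h4 : {morph (fun x => - lie_der x w) : y z / y + z}.
  by move=> y z; rewrite lie_derDl opprD.
have h5 a x : - lie_der (a *: x) w =
    (-1) ^+ q * contraction a w * extv x + a *: (- lie_der x w).
  rewrite lie_derZl opprD addrC scalerN; congr (_ - _).
  rewrite mul_extv grade_inv_sign (parity_gder (contraction_graded a) pw) /=.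
  by rewrite !mulr_sign; case: (q); rewrite /= ?opprK ?mulrN.
have h6 x : parity (~~ ~~ q) (- lie_der x w).
  rewrite negbK; exact/parityN/(parity_gder (lie_der_graded x) pw).
by split; [apply: extend_derP | apply: extend_der_exts | apply: extend_der_extv].
Qed.

Lemma adD q w w' u : parity q w -> parity q w' ->
  ad q (w + w') u = ad q w u + ad q w' u.
Proof.
move=> pw pw'.
have [G S V] := ad_spec pw; have [G' S' V'] := ad_spec pw'.
have [G2 S2 V2] := ad_spec (parityD pw pw').
apply: (gder_eq G2 (gder_add G G')) => [a|x].
  by rewrite S S' S2 (gderD (contraction_graded _)) mulrDr.
by rewrite V V' V2 (gderD (lie_der_graded _)) opprD.
Qed.

Lemma ad_rscale q w u (c : R) : parity q w -> ad q (c *r: w) u = c *r: ad q w u.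
Proof.
move=> pw; rewrite /rscale.
have [G S V] := ad_spec pw.
have [G2 S2 V2] := ad_spec (parityZ (struct_morph A c) pw).
apply: (gder_eq G2 (gder_scale _ G)) => [a|x].
  rewrite S S2 (gderZ (contraction_graded _)) contraction_exts mul0r add0r.
  by rewrite exterior_scaleAr.
rewrite V V2 (gderZ (lie_der_graded _)) lie_der_exts anchor_struct exts0 mul0r add0r.
by rewrite scalerN.
Qed.

(** The component of parity [q]; it exists because 2 is invertible in a real
algebra. *)
Definition parity_part q u : E := 2^-1 *r: (u + (-1) ^+ q * grade_inv u).

Lemma parity_parity_part q u : parity q (parity_part q u).
Proof.
apply/parityZ; rewrite /parity grade_invD grade_inv_sign grade_invK mulrDr mulrA.
by rewrite -expr2 sqrr_sign mul1r addrC.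
Qed.

Lemma parity_partD q u v :
  parity_part q (u + v) = parity_part q u + parity_part q v.
Proof. by rewrite /parity_part /rscale grade_invD mulrDr -scalerDr addrACA. Qed.

Lemma parity_part_id p q u : parity p u ->
  parity_part q u = if p == q then u else 0.
Proof.
move=> pu; rewrite /parity_part pu mulrA -signr_addb mulr_sign /rscale.
case: eqP => [->|/eqP npq]; last first.
  have -> : q (+) p by move: npq; case: (q) (p) => [] [].
  by rewrite subrr scaler0.
have h2 : 2^-1 + 2^-1 = 1 :> R.
  by rewrite -mulr2n -[_ *+ 2]mulr_natl mulfV ?Num.Theory.pnatr_eq0.
by rewrite addbb scalerDr -scalerDl -rmorphD h2 rmorph1 scale1r.
Qed.

(** The sign in [ad] depends on the parity of [w], hence the splitting. *)
Definition bracket w u : E :=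
  ad false (parity_part false w) u + ad true (parity_part true w) u.

Lemma ad0 q u : ad q 0 u = 0.
Proof.
by apply: (addrI (ad q 0 u)); rewrite -adD ?addr0 //; apply: parity0.
Qed.

Lemma bracket_parity q w u : parity q w -> bracket w u = ad q w u.
Proof.
move=> pw; rewrite /bracket !(parity_part_id _ pw).
by case: q pw => _ /=; rewrite ad0 ?addr0 ?add0r.
Qed.

Lemma bracketDl u v w : bracket (u + v) w = bracket u w + bracket v w.
Proof.
rewrite /bracket !parity_partD.
have H q := adD w (parity_parity_part q u) (parity_parity_part q v).
by rewrite !H addrACA.
Qed.

(** The derivation [bracket w] shifts degrees by the antisymmetric degree of [w].
Its parity is [q] in a hypothesis [parity (~~ q) w], since the tensor degree is
one more. *)
Lemma bracket_graded q w : parity (~~ q) w -> graded_der q (bracket w).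
Proof.
move=> pw; have [G _ _] := ad_spec pw; rewrite negbK in G.
have -> // : bracket w = ad (~~ q) w.
by apply/funext=> u; apply: bracket_parity.
Qed.

Lemma bracketDr w u v : bracket w (u + v) = bracket w u + bracket w v.
Proof.
have G q := let: And3 G _ _ := ad_spec (parity_parity_part q w) in G.
by rewrite /bracket !(gderD (G _)) addrACA.
Qed.

Lemma bracket_extsr q w a : parity q w ->
  bracket w (exts g a) = (-1) ^+ q * contraction a w.
Proof. by move=> pw; have [_ S _] := ad_spec pw; rewrite (bracket_parity _ pw). Qed.

Lemma bracket_extvr w x : bracket w (extv x) = - lie_der x w.
Proof.
elim/exterior_wedge_ind: w => [u v Hu Hv|a|n y].
- by rewrite bracketDl Hu Hv (gderD (lie_der_graded x)) opprD.
- by have [_ _ V] := ad_spec (parity_exts g a); rewrite (bracket_parity _ (parity_exts g a)).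
- by have [_ _ V] := ad_spec (parity_wedge y); rewrite (bracket_parity _ (parity_wedge y)).
Qed.

Lemma bracket_extsl a u : bracket (exts g a) u = contraction a u.
Proof.
have G := bracket_graded (parity_exts g a : parity (~~ true) _).
apply: (gder_eq G (contraction_graded a)) => [b|x].
  by rewrite (bracket_extsr _ (parity_exts g a)) !contraction_exts mulr0.
by rewrite bracket_extvr lie_der_exts contraction_extv.
Qed.

Lemma bracket_extvl x u : bracket (extv x) u = lie_der x u.
Proof.
have G := bracket_graded (parity_extv x : parity (~~ false) _).
apply: (gder_eq G (lie_der_graded x)) => [b|y].
  by rewrite (bracket_extsr _ (parity_extv x)) contraction_extv lie_der_exts mulN1r opprK.
by rewrite bracket_extvr !lie_der_extv -extvN -lieC.
Qed.

Lemma bracket_rscalel (c : R) w u : bracket (c *r: w) u = c *r: bracket w u.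
Proof.
have H q : parity_part q (c *r: w) = c *r: parity_part q w.
  by rewrite /parity_part /rscale grade_invZ -exterior_scaleAr -scalerDr !scalerA mulrC.
have K q := ad_rscale u c (parity_parity_part q w).
by rewrite /bracket !H !K /rscale scalerDr.
Qed.

Lemma bracket_rscaler (c : R) w u : bracket w (c *r: u) = c *r: bracket w u.
Proof.
have H q : ad q (parity_part q w) (c *r: u) = c *r: ad q (parity_part q w) u.
  have [G S _] := ad_spec (parity_parity_part q w).
  by rewrite /rscale (gderZ G) S contraction_struct mulr0 mul0r add0r.
by rewrite /bracket !H /rscale scalerDr.
Qed.

(** Expand the second tensor with the derivation [bracket (wedge x)], and then the
first one with the derivations [lie_der] or [contraction] that remain. *)
Lemma bracket_is_schouten : is_schouten L bracket.
Proof.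
split.
- exact: bracketDl.
- by move=> *; apply: bracketDr.
- by move=> a b; rewrite bracket_extsl contraction_exts.
- move=> n x a; rewrite (bracket_extsr _ (parity_wedge x)).
  rewrite (gder_wedge _ (contraction_graded a)) mulr_sumr.
  apply: eq_bigr => i _; rewrite contraction_extv scale_exts.
  rewrite mulNr -(signr_odd _ (n - i)) -(signr_odd _ i) oddB -1?ltnS //.
  by rewrite !mulr_sign oddS; case: (odd n) (odd i) => [] []; rewrite /= ?opprK.
- move=> n x a; rewrite bracket_extsl (gder_wedge _ (contraction_graded a)).
  apply: eq_bigr => i _; rewrite contraction_extv scale_exts exprS.
  by rewrite mulN1r !mulNr mulrN.
- move=> m n x y.
  rewrite (gder_wedge y (bracket_graded (parity_wedge x : parity (~~ odd m) _))).
  rewrite exchange_big; apply: eq_bigr => j _ /=.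
  rewrite bracket_extvr (gder_wedge _ (lie_der_graded _)) -sumrN mulr_suml mulr_sumr.
  apply: eq_bigr => i _; rewrite lie_der_extv lieC extvN exprD.
  rewrite -(signr_odd _ i) -(signr_odd _ j) -mulrA !mulr_sign.
  by case: (odd i) (odd j) => [] []; rewrite /= ?mulNr ?opprK.
Qed.

Lemma is_schouten_unique br br' :
  is_schouten L br -> is_schouten L br' -> br = br'.
Proof.
move=> S S'; apply/funext=> u; apply/funext=> v.
elim/exterior_wedge_ind: u => [u u' Hu Hu'|a|m x].
- by rewrite (schouten_addl S) (schouten_addl S') Hu Hu'.
- elim/exterior_wedge_ind: v => [v v' Hv Hv'|b|n y].
  + by rewrite (schouten_addr S) (schouten_addr S') Hv Hv'.
  + by rewrite (schouten_scal S) (schouten_scal S').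
  + by rewrite (schouten_scal_tensor S) (schouten_scal_tensor S').
- elim/exterior_wedge_ind: v => [v v' Hv Hv'|b|n y].
  + by rewrite (schouten_addr S) (schouten_addr S') Hv Hv'.
  + by rewrite (schouten_tensor_scal S) (schouten_tensor_scal S').
  + by rewrite (schouten_tensor S) (schouten_tensor S').
Qed.

(** * Degree, antisymmetry and Jacobi identity *)

Lemma bracket0l w : bracket 0 w = 0.
Proof. by apply: (addrI (bracket 0 w)); rewrite -bracketDl !addr0. Qed.

Lemma bracket0r w : bracket w 0 = 0.
Proof. by apply: (addrI (bracket w 0)); rewrite -bracketDr !addr0. Qed.

Lemma bracketNl u w : bracket (- u) w = - bracket u w.
Proof. by apply/eqP; rewrite -addr_eq0 -bracketDl addNr bracket0l. Qed.

Lemma bracketNr w u : bracket w (- u) = - bracket w u.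
Proof. by apply/eqP; rewrite -addr_eq0 -bracketDr addNr bracket0r. Qed.

(** Once coefficients are absorbed, this can be read off the explicit formulas. *)
Lemma ext_pow_bracket m n k u v : (m + n = k.+1)%N ->
  ext_pow m u -> ext_pow n v -> ext_pow k (bracket u v).
Proof.
move=> mn pu pv; have S := bracket_is_schouten.
elim/ext_pow_ind: u / pu => [|u u' Hu Hu'|a x].
- by rewrite bracket0l; apply: ext_pow0.
- by rewrite bracketDl; apply: ext_powD.
elim/ext_pow_ind: v / pv => [|v v' Hv Hv'|b y].
- by rewrite bracket0r; apply: ext_pow0.
- by rewrite bracketDr; apply: ext_powD.
case: m x mn => [|m] x mn; last first.
  case: (scale_wedge a x) => {}x ->.
  case: n y mn => [|n] y mn; last first.
    case: (scale_wedge b y) => {}y ->; rewrite (schouten_tensor S).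
    apply: ext_pow_sum => i _; apply: ext_pow_sum => j _; apply: ext_pow_sign.
    have -> : k = (1 + m + n)%N by move: mn; rewrite addSn addnS add1n => -[].
    apply: ext_powM (ext_pow_wedge _).
    exact: ext_powM (ext_pow_extv _) (ext_pow_wedge _).
  rewrite wedge0 (schouten_tensor_scal S).
  have -> : k = m by move: mn; rewrite addn0 => -[].
  by apply: ext_pow_sum => i _; apply/ext_pow_sign/ext_powZ/ext_pow_wedge.
case: n y mn => // n y [<-].
case: (scale_wedge b y) => {}y ->; rewrite wedge0 (schouten_scal_tensor S).
by apply: ext_pow_sum => i _; apply/ext_pow_sign/ext_powZ/ext_pow_wedge.
Qed.

Lemma bracket_ext_pow0 u v : ext_pow 0 u -> ext_pow 0 v -> bracket u v = 0.
Proof.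
move=> pu pv; elim/ext_pow_ind: u / pu => [|u u' Hu Hu'|a x].
- exact: bracket0l.
- by rewrite bracketDl Hu Hu' addr0.
elim/ext_pow_ind: v / pv => [|v v' Hv Hv'|b y].
- exact: bracket0r.
- by rewrite bracketDr Hv Hv' addr0.
by rewrite !wedge0 bracket_extsl contraction_exts.
Qed.

(** The bracket is also a derivation of its first argument. Both sides are graded
derivations in [w], so it is enough to compare them on generators, where they
reduce to the Leibniz rules of [contraction] and [lie_der]. *)
Lemma bracket_mul_extvl p u x w : parity (~~ p) u ->
  bracket (u * extv x) w =
    u * lie_der x w + (-1) ^+ (~~ p) * extv x * bracket u w.
Proof.
move=> pu; have pux : parity (~~ ~~ p) (u * extv x).
  by rewrite -[~~ ~~ p]addbT; apply/parityM/parity_extv.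
have G1 := gder_mull (lie_der_graded x) pu.
have G2 := gder_mull (bracket_graded pu) (parity_sign (~~ p) (parity_extv x)).
rewrite addbF in G1; rewrite addTb in G2.
apply: (gder_eq (bracket_graded pux) (gder_add G1 G2)) => [a|y].
  rewrite (bracket_extsr _ pux) (bracket_extsr _ pu) lie_der_exts.
  rewrite (gderM (contraction_graded a)) contraction_extv mul_extv.
  rewrite (parity_gder (contraction_graded a) pu) /= pu.
  rewrite -mulrA !mulr_sign.
  by case: (p); rewrite /= ?(mulrN, mulNr, opprK, opprD) addrC.
rewrite !bracket_extvr lie_der_extv (gderM (lie_der_graded y)) lie_der_extv.
rewrite mul_extv (parity_gder (lie_der_graded y) pu) (lieC x y) extvN -mulrA !mulr_sign.
by case: (p); rewrite /= ?(mulrN, mulNr, opprK, opprD) addrC.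
Qed.

(** For a simple tensor, induction on the number of factors: splitting off the
last vector gives, by the Leibniz rules in either argument, the same two terms.
The parity components make the statement additive in [u], so that simple
tensors suffice. *)
Lemma bracketC p q u w : parity (~~ p) u -> parity (~~ q) w ->
  bracket u w = - ((-1) ^+ (p && q) * bracket w u).
Proof.
move=> pu pw.
have Hs a : bracket (exts g a) w = - ((-1) ^+ q * bracket w (exts g a)).
  rewrite bracket_extsl (bracket_extsr _ pw) !mulr_sign.
  by case: (q); rewrite /= ?opprK.
have Hw n (x : 'I_n -> g) :
  bracket (wedge x) w = - ((-1) ^+ (~~ odd n && q) * bracket w (wedge x)).
  elim: n x => [|n IHn] x.
    by have -> : wedge x = exts g 1 by rewrite wedge0 exts1.
  set p' := ~~ odd n in IHn.
  rewrite wedge_recr; move: {x}(fun i => _) (x ord_max) => y x.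
  have py : parity (~~ p') (wedge y) by rewrite negbK; apply: parity_wedge.
  rewrite (bracket_mul_extvl _ _ py) IHn (gderM (bracket_graded pw)).
  rewrite bracket_extvr mul_extv (parity_gder (bracket_graded pw) py).
  rewrite (parity_twist _ py) oddS -/p'.
  rewrite -mulrA !mulr_sign.
  by case: (p') (q) => [] [];
    rewrite /= ?(mulrN, mulNr, opprK, opprD) addrC.
suff H v : bracket (parity_part (~~ p) v) w =
    - ((-1) ^+ (p && q) * bracket w (parity_part (~~ p) v)).
  by have := H u; rewrite (parity_part_id _ pu) eqxx.
elim/exterior_wedge_ind: v => [v v' Hv Hv'|a|n x].
- by rewrite parity_partD bracketDl bracketDr Hv Hv' [in RHS]mulrDr opprD.
- rewrite (parity_part_id _ (parity_exts g a)); case: (p) => /=; first exact: Hs.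
  by rewrite bracket0l bracket0r mulr0 oppr0.
- rewrite (parity_part_id _ (parity_wedge x)); case: eqP => [np|_].
    by rewrite Hw np negbK.
  by rewrite bracket0l bracket0r mulr0 oppr0.
Qed.

(** The defect of the Jacobi identity: how far the bracket with [bracket u v] is
from the graded commutator of the brackets with [u] and with [v]. *)
Definition jacobiator p q u v w := bracket (bracket u v) w -
  (bracket u (bracket v w) - (-1) ^+ (p && q) * bracket v (bracket u w)).

Lemma parity_bracket p q u v : parity (~~ p) u -> parity (~~ q) v ->
  parity (~~ (p (+) q)) (bracket u v).
Proof.
move=> pu pv; rewrite -addbN; exact: (parity_gder (bracket_graded pu) pv).
Qed.

Lemma jacobiator_graded p q u v : parity (~~ p) u -> parity (~~ q) v ->
  graded_der (p (+) q) (jacobiator p q u v).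
Proof.
move=> pu pv; apply: gder_add; first exact/bracket_graded/parity_bracket.
exact/gder_opp/(gder_comm (bracket_graded pu))/bracket_graded.
Qed.

(** Antisymmetry turns the three double brackets of either side into one
another. *)
Lemma jacobiator_rot p q r u v w :
    parity (~~ p) u -> parity (~~ q) v -> parity (~~ r) w ->
  jacobiator q r v w u =
    (-1) ^+ ((p && q) (+) (p && r)) * jacobiator p q u v w.
Proof.
move=> pu pv pw; rewrite /jacobiator.
rewrite (bracketC (parity_bracket pv pw) pu) (bracketC pw pu) (bracketC pv pu).
rewrite !(bracketNr, gder_sign (bracket_graded pv), gder_sign (bracket_graded pw)).
rewrite (bracketC pw (parity_bracket pu pv)) !mulr_sign.
move: (bracket u (bracket v w)) (bracket v (bracket u w)) => X Y.
move: (bracket (bracket u v) w) => Z.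
by case: (p) (q) (r) => [] [] [];
  rewrite /= ?(opprK, opprD) [RHS]addrC -addrA.
Qed.

Definition gen (s : A + g) : E :=
  match s with inl a => exts g a | inr x => extv x end.
(** The antisymmetric degree modulo 2: it is -1 for scalars and 0 for vectors. *)
Definition gen_deg (s : A + g) : bool := if s is inl _ then true else false.

Lemma parity_gen s : parity (~~ gen_deg s) (gen s).
Proof. by case: s => [a|x]; [apply: parity_exts|apply: parity_extv]. Qed.

(** With two scalars or more every term vanishes. With a single one this is the
compatibility of the anchor with brackets, and with none the Jacobi identity
of the Lie algebra. *)
Lemma jacobiator_gen s t k :
  jacobiator (gen_deg s) (gen_deg t) (gen s) (gen t) (gen k) = 0.
Proof.
have bss a b : bracket (exts g a) (exts g b) = 0.
  by rewrite bracket_extsl contraction_exts.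
have bsv a x : bracket (exts g a) (extv x) = - exts g (anchor x a).
  by rewrite bracket_extsl contraction_extv.
have bvs x a : bracket (extv x) (exts g a) = exts g (anchor x a).
  by rewrite bracket_extvl lie_der_exts.
have bvv x y : bracket (extv x) (extv y) = extv (lie x y).
  by rewrite bracket_extvl lie_der_extv.
have bE := (bss, bsv, bvs, bvv, bracketNl, bracketNr, bracket0l, bracket0r).
case: s t k => [a|x] [b|y] [c|z]; rewrite /jacobiator /= !(mul1r, mulN1r) !bE.
all: rewrite ?(oppr0, addr0, subrr, add0r) ?bE ?(oppr0, addr0, subrr, add0r) //.
- by rewrite !opprK anchor_lie extsD extsN opprB subrK subrr.
- by rewrite !opprK anchor_lie extsD extsN addKr subrr.
- by rewrite anchor_lie extsD extsN subrr.
- have -> : lie (lie x y) z = lie x (lie y z) - lie y (lie x z).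
    apply/eqP; rewrite (lieC _ z) (lieC x z) lieNr opprK eq_sym -subr_eq0 opprK.
    exact/eqP/lie_jacobi.
  by rewrite extvD extvN subrr.
Qed.

Lemma gder_eq0 p D : graded_der p D ->
  (forall s, D (gen s) = 0) -> forall u, D u = 0.
Proof.
move=> gD H u; apply: (gder_eq gD (gder_zero g p)) => [a|x].
  exact: (H (inl a)).
exact: (H (inr x)).
Qed.

(** Vanishing on generators is extended to one argument at a time: each argument
is rotated into the third slot, in which the defect is a derivation. *)
Lemma bracket_jacobiator p q u v w :
  parity (~~ p) u -> parity (~~ q) v -> jacobiator p q u v w = 0.
Proof.
have rot p1 q1 r1 u1 v1 w1 :
    parity (~~ p1) u1 -> parity (~~ q1) v1 -> parity (~~ r1) w1 ->
    jacobiator q1 r1 v1 w1 u1 = 0 -> jacobiator p1 q1 u1 v1 w1 = 0.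
  move=> pu pv pw J.
  by rewrite (jacobiator_rot pw pu pv) (jacobiator_rot pv pw pu) J !mulr0.
have J1 s t w1 : jacobiator (gen_deg s) (gen_deg t) (gen s) (gen t) w1 = 0.
  have G := jacobiator_graded (parity_gen s) (parity_gen t).
  exact: gder_eq0 G (jacobiator_gen s t) w1.
have J2 p1 u1 s w1 :
    parity (~~ p1) u1 -> jacobiator p1 (gen_deg s) u1 (gen s) w1 = 0.
  move=> pu; apply: gder_eq0 (jacobiator_graded pu (parity_gen s)) _ w1 => t.
  exact: rot pu (parity_gen s) (parity_gen t) (J1 s t u1).
move=> pu pv; apply: gder_eq0 (jacobiator_graded pu pv) _ w => t.
exact: rot pu pv (parity_gen t) (J2 q v t u pv).
Qed.

Lemma bracket_jacobi p q r u v w :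
    parity (~~ p) u -> parity (~~ q) v -> parity (~~ r) w ->
  (-1) ^+ (p && r) * bracket u (bracket v w)
  + (-1) ^+ (p && q) * bracket v (bracket w u)
  + (-1) ^+ (q && r) * bracket w (bracket u v) = 0.
Proof.
move=> pu pv pw; have := bracket_jacobiator w pu pv; rewrite /jacobiator.
rewrite (bracketC pw pu) (bracketC pw (parity_bracket pu pv)).
rewrite !(bracketNr, gder_sign (bracket_graded pv)).
move=> /eqP; rewrite subr_eq0 => /eqP ->; rewrite !mulr_sign.
move: (bracket u (bracket v w)) (bracket v (bracket u w)) => X Y.
by case: (p) (q) (r) => [] [] [];
  rewrite /= ?(opprK, opprD) addrACA ?(subrr, addNr) addr0.
Qed.

End Bracket.

(** * Integer degrees *)

Lemma sign_rscale (R : realType) (A : comRealAlg R) (g : lmodType A) (d : int)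
    (u : exterior g) : (-1) ^ d *r: u = (-1) ^+ odd `|d| * u.
Proof.
have -> : (-1) ^ d = (-1) ^+ odd `|d| :> R.
  by rewrite signr_odd; case: d => n //; rewrite /exprz invr_sign.
rewrite /rscale !mulr_sign.
by case: odd; rewrite ?expr1 ?expr0 ?rmorphN rmorph1 ?scaleN1r ?scale1r.
Qed.

Lemma odd_abszB1 (d : int) : odd `|d - 1| = ~~ odd `|d|.
Proof.
case: d => [[|n]|n] //; last by rewrite NegzE -opprD abszN -PoszD addn1.
by rewrite -[n.+1]addn1 PoszD addrK /= addn1 /= negbK.
Qed.

Section Degree.
Variables (A : comPzRingType) (g : lmodType A).

Lemma has_deg_parity (d : int) (u : exterior g) :
  has_deg d u -> parity (~~ odd `|d|) u.
Proof.
rewrite /has_deg -[in ~~ _](addrK 1 d); case: (d + 1) => n; last first.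
  by move->; apply: parity0.
by move=> /parity_ext_pow; rewrite odd_abszB1 negbK.
Qed.

Lemma has_deg_ext_pow (n : nat) (u : exterior g) :
  ext_pow n u -> has_deg (n%:Z - 1) u.
Proof. by rewrite /has_deg subrK. Qed.

Lemma has_deg0 (d : int) : has_deg d (0 : exterior g).
Proof. by rewrite /has_deg; case: (d + 1) => n //; apply: ext_pow0. Qed.
End Degree.

Lemma has_deg_bracket (R : realType) (A : comRealAlg R) (g : lmodType A)
    (L : lieRinehart g) (anchorA : anchor_Alinear L) (dx dy : int)
    (x y : exterior g) :
  has_deg dx x -> has_deg dy y -> has_deg (dx + dy) (bracket L x y).
Proof.
have -> : dx + dy = (dx + 1) + (dy + 1) - 1 - 1.
  by rewrite addrACA -[RHS]addrA -opprD addrK.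
rewrite {1 2}/has_deg; case: (dx + 1) => m; last first.
  by move=> ->; rewrite bracket0l // => _; apply: has_deg0.
case: (dy + 1) => n; last first.
  by move=> _ ->; rewrite bracket0r //; apply: has_deg0.
case E: (m + n)%N => [|k] px py.
  move: E px py => /eqP; rewrite addn_eq0 => /andP[/eqP-> /eqP->] px py.
  by rewrite (bracket_ext_pow0 anchorA px py); apply: has_deg0.
have -> : m%:Z + n%:Z - 1 = k by rewrite -PoszD E -addn1 PoszD addrK.
exact/has_deg_ext_pow/(ext_pow_bracket anchorA E).
Qed.

Theorem theorem2p15 (R : realType) (A : comRealAlg R) (g : lmodType A)
    (L : lieRinehart g) (anchorA : anchor_Alinear L) :
  (exists! br : exterior g -> exterior g -> exterior g, is_schouten L br)
  /\
  forall br : exterior g -> exterior g -> exterior g, is_schouten L br ->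
    (forall (r : R) (x y z : exterior g),
       br (r *r: x + y) z = r *r: br x z + br y z /\
       br z (r *r: x + y) = r *r: br z x + br z y)
    /\
    (forall (dx dy : int) (x y : exterior g),
       has_deg dx x -> has_deg dy y -> has_deg (dx + dy) (br x y))
    /\
    (forall (dx dy : int) (x y : exterior g),
       has_deg dx x -> has_deg dy y ->
       br x y = - ((-1) ^ (dx * dy) *r: br y x))
    /\
    (forall (dx dy dz : int) (x y z : exterior g),
       has_deg dx x -> has_deg dy y -> has_deg dz z ->
       br x (y * z) = br x y * z + (-1) ^ (dx * (dy - 1)) *r: (y * br x z))
    /\
    (forall (dx dy dz : int) (x y z : exterior g),
       has_deg dx x -> has_deg dy y -> has_deg dz z ->
       (-1) ^ (dx * dz) *r: br x (br y z)
       + (-1) ^ (dx * dy) *r: br y (br z x)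
       + (-1) ^ (dy * dz) *r: br z (br x y) = 0).
Proof.
have S := bracket_is_schouten anchorA; split.
  by exists (bracket L); split=> // br; apply: is_schouten_unique.
move=> br /(is_schouten_unique S) <- {br}; do !split.
- by rewrite bracketDl // bracket_rscalel.
- by rewrite bracketDr // bracket_rscaler.
- exact: has_deg_bracket.
- move=> dx dy x y /has_deg_parity px /has_deg_parity py.
  by rewrite sign_rscale abszM oddM -(bracketC anchorA px py).
- move=> dx dy dz x y z /has_deg_parity px /has_deg_parity py _.
  rewrite (gderM (bracket_graded anchorA px)) sign_rscale abszM oddM odd_abszB1.
  by rewrite (parity_twist _ py) mulrA.
- move=> dx dy dz x y z /has_deg_parity px /has_deg_parity py /has_deg_parity pz.
  by rewrite !sign_rscale !abszM !oddM; apply: bracket_jacobi.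
Qed.
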